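(* Let $\{v_1,\dots,v_k\}\subset\mathbb{R}^n$, $k\le n$, be an orthonormal set of vectors, let $\lambda_1\ge\cdots\ge\lambda_k>0$, let $\theta>0$ be the cluster point, define $\alpha_i=1-\frac{\theta}{\lambda_i}$ for $i=1,\dots,k$, and $H_k=\prod_{i=1}^k(I_n-\alpha_iv_iv_i^T)$. Let $\beta_1,\dots,\beta_k\in\mathbb{R}$, not all zero, and $y_D=\sum_{i=1}^k\beta_iv_i$. Let $\operatorname{fl}(H_ky_D)$ be the vector computed in floating-point arithmetic by applying the rank-one factors successively for $i=1,\dots,k$ (rounding model in the context). Then $$\frac{\|H_ky_D-\operatorname{fl}(H_ky_D)\|}{\|H_ky_D\|}\le C_D(\theta)\Big(ku+\gamma_n\sum_{i=1}^k|\alpha_i|\Big)+\mathcal O(u^2),$$ where $$C_D(\theta)=\begin{cases}\dfrac{\theta}{\lambda_k},&\theta\ge\lambda_1,\\[2mm]\dfrac{\lambda_1}{\lambda_k},&\lambda_k\le\theta<\lambda_1,\\[2mm]\dfrac{\lambda_1}{\theta},&0<\theta<\lambda_k.\end{cases}$$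
   Context: Notation: $\|\cdot\|$ is the Euclidean norm; $\circ$ is the Hadamard (elementwise) product; $\mathbf 1=(1,\dots,1)^T\in\mathbb{R}^n$; $u>0$ is the unit roundoff with $nu<1$, and $\gamma_n=\frac{nu}{1-nu}$. Floating-point model. For $a,b\in\mathbb{R}^n$, $\operatorname{fl}(a^Tb)=a^Tb+\delta$ with $|\delta|\le\gamma_n\|a\|\|b\|$. The computed vector $\operatorname{fl}(H_ky_D)=\widehat y^{(k)}$ is defined by $\widehat y^{(0)}=y_D$ and, for $i=1,\dots,k$, $$\widehat y^{(i)}=\Big[\widehat y^{(i-1)}-\alpha_i\big(v_i^T\widehat y^{(i-1)}+\varepsilon_i\big)v_i\Big]\circ(\mathbf 1+\mu_i)+\mathcal O(u^2),$$ where $\varepsilon_i\in\mathbb{R}$ is the rounding error of the $i$-th inner product, $|\varepsilon_i|\le\gamma_n\|\widehat y^{(i-1)}\|$, and $\mu_i\in\mathbb{R}^n$ is the componentwise relative error of the $i$-th rank-one update, $\|\mu_i\|_\infty\le u$. $\mathcal O(u^2)$ denotes terms bounded by a constant times $u^2$ as $u\to0$, with the constant depending only on the fixed data ($n$, $k$, $\theta$, $\lambda_i$, $v_i$, $\beta_i$). *)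

(* Defs.v *)
From HB Require Import structures.
From mathcomp Require Import all_boot all_order all_algebra.
From mathcomp Require Import all_classical all_reals all_analysis.

Set Implicit Arguments.
Unset Strict Implicit.
Unset Printing Implicit Defensive.

Import Order.TTheory GRing.Theory Num.Theory.
Import numFieldNormedType.Exports.
Local Open Scope classical_set_scope.
Local Open Scope ring_scope.

Section Deflation.
Variables (R : realType) (n k : nat).
Implicit Types (a b y z : 'cV[R]_n) (v : 'I_k -> 'cV[R]_n).
Implicit Types (lam beta : 'I_k -> R) (theta u : R).

Definition dotv a b : R := (a^T *m b) 0 0.

(* The norm of the library on matrices, `|a|, is the maximum norm. *)
Definition norm2 a : R := Num.sqrt (\sum_(j < n) a j 0 ^+ 2).

Definition hadamard a b : 'cV[R]_n := map2_mx *%R a b.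

Definition orthonormal_family v : Prop :=
  forall i j : 'I_k, dotv (v i) (v j) = (i == j)%:R.

Definition gamma u : R := n%:R * u / (1 - n%:R * u).

Definition alpha theta lam (i : 'I_k) : R := 1 - theta / lam i.

Definition Hmat theta lam v : 'M[R]_n :=
  \prod_(i < k) (1%:M - alpha theta lam i *: (v i *m (v i)^T)).

Definition yD beta v : 'cV[R]_n := \sum_(i < k) beta i *: v i.

(* One rounded application of I - al w w^T to y, with result z. The vector   *)
(* rho is the O(u^2) term, with constant K; `|mu| is the maximum norm of mu. *)
Definition fl_step (K u al : R) (w y z : 'cV[R]_n) : Prop :=
  exists (eps : R) (mu rho : 'cV[R]_n),
    [/\ `|eps| <= gamma u * norm2 y,
        `|mu| <= u,
        norm2 rho <= K * u ^+ 2 &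
        z = hadamard (y - (al * (dotv w y + eps)) *: w) (const_mx 1 + mu)
            + rho].

(* z is a possible value of fl(H_k y): the rounding errors are not determined *)
(* by u, hence a relation. Only yhat 0, ..., yhat k are constrained.         *)
Definition fl_H (K u theta : R) lam v y z : Prop :=
  exists yhat : nat -> 'cV[R]_n,
    [/\ yhat 0%N = y,
        forall i : 'I_k,
          fl_step K u (alpha theta lam i) (v i) (yhat i) (yhat i.+1) &
        yhat k = z].

End Deflation.

Arguments gamma {R} n u.

Definition CD (R : realType) (theta lam_first lam_last : R) : R :=
  if lam_first <= theta then theta / lam_last
  else if lam_last <= theta then lam_first / lam_last
  else lam_first / theta.

(* Main.v *)
Require Import Defs.
From HB Require Import structures.
From mathcomp Require Import all_boot all_order all_algebra.
From mathcomp Require Import all_classical all_reals all_analysis.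
From mathcomp Require Import ring lra.

Set Implicit Arguments.
Unset Strict Implicit.
Unset Printing Implicit Defensive.

Import Order.TTheory GRing.Theory Num.Theory.
Import numFieldNormedType.Exports.
Local Open Scope classical_set_scope.
Local Open Scope ring_scope.

(** The factors [I - alpha_i v_i v_i^T] are simultaneously diagonal: each
    multiplies the component along [v_i] by [c_i = theta / lambda_i] and fixes
    the orthogonal complement of [v_i].  So every product of some of the
    factors, or of their inverses, is an operator [stretch v d] that multiplies
    the component along [v_j] by [d_j] and is the identity orthogonally to all
    the [v_j]; its norm is at most [max (1, max_j |d_j|)] by Bessel's inequality
    ([norm2_stretch]).

    Let [p = max (1, lambda_1 / theta)] and [q = max (1, theta / lambda_k)].  A
    partial product is recovered from the whole product by undoing the factors
    still to come, which costs at most [p]: each exact iterate satisfies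
    [|y_i| <= p |H y|] ([norm2_applied]).  The product of the factors still to
    come amplifies an error by at most [q] ([norm2_pending]).  In each of the
    three cases for [theta] the constant [C_D(theta)] equals [q p].

    To first order, step [i] creates two errors.  The rounded inner product
    contributes a multiple of [v_i] of size at most
    [|alpha_i| gamma_n |y_(i-1)|]; the later factors fix [v_i], so it reaches
    the result with size at most [|alpha_i| gamma_n p |H y|].  The rounded
    update contributes a vector of size at most [u |y_i|], which reaches the
    result with size at most [q p u |H y|].  Adding up gives the theorem.

    [fl_iter_error] makes this precise by induction on the steps, following the
    error after the remaining exact factors have been applied to it, together
    with a crude [O(u)] bound on the error itself that turns all products of
    two errors into [O(u^2)]. *)

(** * Inner product and Euclidean norm *)

Lemma dotvE (R : realType) (n : nat) (a b : 'cV[R]_n) :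
  dotv a b = \sum_(j < n) a j 0 * b j 0.
Proof. by rewrite /dotv mxE; apply: eq_bigr => j _; rewrite mxE. Qed.

Lemma dotvC (R : realType) (n : nat) (a b : 'cV[R]_n) : dotv a b = dotv b a.
Proof. by rewrite !dotvE; apply: eq_bigr => j _; rewrite mulrC. Qed.

Lemma dotvDr (R : realType) (n : nat) (a b c : 'cV[R]_n) :
  dotv a (b + c) = dotv a b + dotv a c.
Proof. by rewrite /dotv mulmxDr mxE. Qed.

Lemma dotvZr (R : realType) (n : nat) (t : R) (a b : 'cV[R]_n) :
  dotv a (t *: b) = t * dotv a b.
Proof. by rewrite /dotv -scalemxAr mxE. Qed.

Lemma dotv_sumr (R : realType) (n : nat) (I : finType) (a : 'cV[R]_n)
    (F : I -> 'cV[R]_n) : dotv a (\sum_i F i) = \sum_i dotv a (F i).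
Proof. by rewrite /dotv mulmx_sumr summxE. Qed.

Lemma norm2_ge0 (R : realType) (n : nat) (a : 'cV[R]_n) : 0 <= norm2 a.
Proof. exact: sqrtr_ge0. Qed.

Lemma norm2_sqr (R : realType) (n : nat) (a : 'cV[R]_n) :
  norm2 a ^+ 2 = dotv a a.
Proof.
rewrite sqr_sqrtr; last by apply: sumr_ge0 => j _; apply: sqr_ge0.
by rewrite dotvE; apply: eq_bigr => j _; rewrite expr2.
Qed.

Lemma norm2Z (R : realType) (n : nat) (t : R) (a : 'cV[R]_n) :
  norm2 (t *: a) = `|t| * norm2 a.
Proof.
apply/eqP; rewrite -(@eqrXn2 _ 2) ?mulr_ge0 ?norm2_ge0 //.
by rewrite exprMn !norm2_sqr real_normK ?num_real // dotvZr dotvC dotvZr mulrA.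
Qed.

Lemma norm2N (R : realType) (n : nat) (a : 'cV[R]_n) : norm2 (- a) = norm2 a.
Proof. by rewrite -scaleN1r norm2Z normrN1 mul1r. Qed.

Lemma dotv_norm2_0 (R : realType) (n : nat) (a b : 'cV[R]_n) :
  norm2 a = 0 -> dotv a b = 0.
Proof.
move=> /eqP; rewrite -sqrf_eq0 norm2_sqr dotvE psumr_eq0.
  move=> /allP h; rewrite dotvE big1 // => j _.
  have := h j (mem_index_enum _).
  by rewrite /= mulf_eq0 orbb => /eqP ->; rewrite mul0r.
by move=> j _; rewrite -expr2 sqr_ge0.
Qed.

(** Cauchy-Schwarz, from the nonnegativity of the squared norm of
    [|b| a - |a| b], which equals [2 |a| |b| (|a| |b| - a . b)]; a vanishing norm
    is a separate case because of the division by [|a| |b|]. *)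
Lemma dotv_le_norm2 (R : realType) (n : nat) (a b : 'cV[R]_n) :
  dotv a b <= norm2 a * norm2 b.
Proof.
have [s0|s0] := eqVneq (norm2 a * norm2 b) 0; last first.
  have hs : 0 < norm2 a * norm2 b by rewrite lt0r s0 mulr_ge0 ?norm2_ge0.
  have := sqr_ge0 (norm2 (norm2 b *: a + (- norm2 a) *: b)).
  rewrite norm2_sqr !dotvDr !dotvZr ![dotv (_ + _) _]dotvC !dotvDr !dotvZr.
  rewrite [dotv b a]dotvC -!norm2_sqr => h.
  rewrite -(ler_pM2l hs); nra.
rewrite s0; move/eqP: s0; rewrite mulf_eq0 => /orP[] /eqP /dotv_norm2_0 h.
  by rewrite h.
by rewrite dotvC h.
Qed.

Lemma norm2D (R : realType) (n : nat) (a b : 'cV[R]_n) :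
  norm2 (a + b) <= norm2 a + norm2 b.
Proof.
rewrite -(@ler_pXn2r _ 2) ?nnegrE ?addr_ge0 ?norm2_ge0 //.
rewrite norm2_sqr dotvDr ![dotv (_ + _) _]dotvC !dotvDr [dotv b a]dotvC.
rewrite -!norm2_sqr; have := dotv_le_norm2 a b; nra.
Qed.

(** This is where the maximum norm of the relative errors and the Euclidean norm
    of the iterates meet, with no dimension factor. *)
Lemma norm2_hadamard (R : realType) (n : nat) (a b : 'cV[R]_n) :
  norm2 (hadamard a b) <= `|b| * norm2 a.
Proof.
rewrite -(@ler_pXn2r _ 2) ?nnegrE ?mulr_ge0 ?norm2_ge0 //.
rewrite exprMn !norm2_sqr !dotvE mulr_sumr; apply: ler_sum => j _.
have hb : `|b j 0| <= `|b|.
  rewrite [leRHS](mx_normrE b).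
  exact: (le_bigmax _ (fun i : 'I_n * 'I_1 => `|b i.1 i.2|) (j, 0)).
rewrite !mxE -!expr2 exprMn mulrC ler_wpM2r ?sqr_ge0 //.
by rewrite -real_normK ?num_real // ler_pXn2r ?nnegrE.
Qed.

(** * Operators diagonal along an orthonormal family *)

Section Stretch.
Variables (R : realType) (n k : nat) (v : 'I_k -> 'cV[R]_n).

Definition stretch (c : 'I_k -> R) : 'M[R]_n :=
  1%:M + \sum_(j < k) (c j - 1) *: (v j *m (v j)^T).

Lemma stretch_vec c (x : 'cV[R]_n) :
  stretch c *m x = x + \sum_(j < k) ((c j - 1) * dotv (v j) x) *: v j.
Proof.
rewrite mulmxDl mul1mx mulmx_suml; congr (_ + _); apply: eq_bigr => j _.
rewrite -scalemxAl -mulmxA [(v j)^T *m x]mx11_scalar mul_mx_scalar.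
by rewrite scalerA.
Qed.

Lemma eq_stretch c d : c =1 d -> stretch c = stretch d.
Proof. by move=> h; congr (_ + _); apply: eq_bigr => j _; rewrite h. Qed.

Lemma stretch1 c : (forall j, c j = 1) -> stretch c = 1%:M.
Proof.
move=> h; rewrite /stretch big1 ?addr0 // => j _.
by rewrite h subrr scale0r.
Qed.

Lemma stretch_single (i : 'I_k) (t : R) :
  stretch (fun j => if j == i then t else 1) =
  1%:M - (1 - t) *: (v i *m (v i)^T).
Proof.
rewrite /stretch (bigD1 i) //= eqxx big1 => [|j /negPf ->].
  by rewrite addr0 -scaleNr opprB.
by rewrite subrr scale0r.
Qed.

Hypothesis orthoV : orthonormal_family v.

Lemma dotv_stretch c (i : 'I_k) (x : 'cV[R]_n) :
  dotv (v i) (stretch c *m x) = c i * dotv (v i) x.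
Proof.
rewrite stretch_vec dotvDr dotv_sumr (bigD1 i) //= big1 => [|j ji].
  rewrite dotvZr orthoV eqxx mulr1; ring.
by rewrite dotvZr orthoV eq_sym (negPf ji) mulr0.
Qed.

Lemma stretch_mul c d (x : 'cV[R]_n) :
  stretch c *m (stretch d *m x) = stretch (fun j => c j * d j) *m x.
Proof.
rewrite stretch_vec (stretch_vec d) (stretch_vec (fun j => c j * d j)).
rewrite -addrA -big_split /=.
congr (_ + _); apply: eq_bigr => j _.
rewrite -(stretch_vec d) dotv_stretch -scalerDl; congr (_ *: _); ring.
Qed.

Lemma stretch_vec_fixed c i (hi : c i = 1) : stretch c *m v i = v i.
Proof.
rewrite stretch_vec big1 ?addr0 // => j _; rewrite orthoV.
by have [->|_] := eqVneq j i; rewrite ?hi ?mulr0 ?scale0r // subrr mul0r scale0r.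
Qed.

Lemma norm2_stretch_sqr c (x : 'cV[R]_n) :
  norm2 (stretch c *m x) ^+ 2 =
  norm2 x ^+ 2 + \sum_(j < k) (c j ^+ 2 - 1) * dotv (v j) x ^+ 2.
Proof.
rewrite norm2_sqr {2}stretch_vec dotvDr dotv_sumr dotvC stretch_vec.
rewrite dotvDr dotv_sumr -norm2_sqr -addrA -big_split /=; congr (_ + _).
apply: eq_bigr => j _; rewrite -stretch_vec !dotvZr [dotv (stretch _ *m _) _]dotvC.
rewrite dotv_stretch [dotv x _]dotvC; ring.
Qed.

(** The right-hand side minus the left-hand side is the squared norm of the
    residual [x - sum_j (v_j . x) v_j], which is the stretch by zero of [x]. *)
Lemma bessel (x : 'cV[R]_n) : \sum_(j < k) dotv (v j) x ^+ 2 <= norm2 x ^+ 2.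
Proof.
have := sqr_ge0 (norm2 (stretch (fun=> 0) *m x)).
rewrite norm2_stretch_sqr expr0n /= sub0r -mulr_sumr mulN1r; lra.
Qed.

(** The family need not span: the assumption [1 <= C] pays for the component
    orthogonal to it, which is not stretched. *)
Lemma norm2_stretch c C (x : 'cV[R]_n) (hC : 1 <= C)
    (hc : forall j, `|c j| <= C) :
  norm2 (stretch c *m x) <= C * norm2 x.
Proof.
have C0 : 0 <= C by lra.
rewrite -(@ler_pXn2r _ 2) ?nnegrE ?mulr_ge0 ?norm2_ge0 //.
rewrite norm2_stretch_sqr exprMn.
have h : \sum_(j < k) (c j ^+ 2 - 1) * dotv (v j) x ^+ 2
    <= (C ^+ 2 - 1) * \sum_(j < k) dotv (v j) x ^+ 2.
  rewrite mulr_sumr; apply: ler_sum => j _; rewrite ler_wpM2r ?sqr_ge0 //.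
  by rewrite lerD2r -real_normK ?num_real // ler_pXn2r ?nnegrE.
have : 0 <= (C ^+ 2 - 1) * (norm2 x ^+ 2 - \sum_(j < k) dotv (v j) x ^+ 2).
  by rewrite mulr_ge0 ?subr_ge0 ?bessel // exprn_ege1.
lra.
Qed.

(** Induction over the list of indices: the stretched directions are those
    already listed, and each new index is fresh because the list has no
    repetition. *)
Lemma prod_stretch c (x : 'cV[R]_n) :
  (\prod_(i < k) (1%:M - (1 - c i) *: (v i *m (v i)^T))) *m x = stretch c *m x.
Proof.
have: uniq (index_enum 'I_k) by rewrite index_enum_uniq.
rewrite (@eq_stretch c (fun j => if j \in index_enum 'I_k then c j else 1)).
  elim: (index_enum 'I_k) x => [|i r IH] x /=.
    by rewrite big_nil stretch1.
  move=> /andP[ir ur]; rewrite big_cons -mulmxA IH // -stretch_single stretch_mul.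
  congr (_ *m _); apply: eq_stretch => j; rewrite inE.
  by have [->|_] := eqVneq j i; rewrite ?(negPf ir) ?mulr1 ?mul1r.
by move=> j; rewrite mem_index_enum.
Qed.

End Stretch.

(** * Propagation of the rounding errors *)

Section ErrorPropagation.
Variables (R : realType) (n k : nat) (v : 'I_k -> 'cV[R]_n).
Hypothesis orthoV : orthonormal_family v.
Variables (c : 'I_k -> R) (p q : R).
Hypotheses (p1 : 1 <= p) (q1 : 1 <= q).
Hypotheses (c_gt0 : forall j, 0 < c j) (c_leq : forall j, c j <= q).
Hypothesis cV_lep : forall j, (c j)^-1 <= p.

(** The product of the factors with index below [m]; [pending m] is the product
    of the others. *)
Definition applied (m : nat) : 'M[R]_n :=
  stretch v (fun j => if (j < m)%N then c j else 1).

Definition pending (m : nat) : 'M[R]_n :=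
  stretch v (fun j => if (j < m)%N then 1 else c j).

Definition factor (i : 'I_k) : 'M[R]_n :=
  stretch v (fun j => if j == i then c i else 1).

Lemma factor_applied (i : 'I_k) (x : 'cV[R]_n) :
  factor i *m (applied i *m x) = applied i.+1 *m x.
Proof.
rewrite stretch_mul //; congr (_ *m _); apply: eq_stretch => j.
rewrite /= ltnS [(j <= i)%N]leq_eqVlt.
have [->|ji] := eqVneq j i; first by rewrite ltnn eqxx mulr1.
by rewrite (negPf ji : (j == i :> nat) = false) mul1r.
Qed.

Lemma pending_factor (i : 'I_k) (x : 'cV[R]_n) :
  pending i.+1 *m (factor i *m x) = pending i *m x.
Proof.
rewrite stretch_mul //; congr (_ *m _); apply: eq_stretch => j.
rewrite /= ltnS [(j <= i)%N]leq_eqVlt.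
have [->|ji] := eqVneq j i; first by rewrite ltnn eqxx mul1r.
by rewrite (negPf ji : (j == i :> nat) = false) mulr1.
Qed.

(** The reason why the error of the inner product, directed along [v i], is not
    amplified by [q]. *)
Lemma pending_vec (i : 'I_k) : pending i.+1 *m v i = v i.
Proof. by rewrite stretch_vec_fixed // ltnSn. Qed.

(** [applied m *m x] is the full product followed by the inverses of the factors
    with index at least [m], and those inverses have norm at most [p]. *)
Lemma norm2_applied (m : nat) (x : 'cV[R]_n) :
  norm2 (applied m *m x) <= p * norm2 (stretch v c *m x).
Proof.
have -> : applied m *m x =
    stretch v (fun j => if (j < m)%N then 1 else (c j)^-1) *m (stretch v c *m x).
  rewrite stretch_mul //; congr (_ *m _); apply: eq_stretch => j /=.
  by case: ifP => _; rewrite ?mul1r // mulVf // gt_eqF.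
apply: norm2_stretch => // j; case: ifP => _; first by rewrite normr1.
by rewrite gtr0_norm ?invr_gt0.
Qed.

Lemma norm2_pending (m : nat) (x : 'cV[R]_n) :
  norm2 (pending m *m x) <= q * norm2 x.
Proof.
apply: norm2_stretch => // j; case: ifP => _; first by rewrite normr1.
by rewrite gtr0_norm.
Qed.

Lemma norm2_factor (i : 'I_k) (x : 'cV[R]_n) :
  norm2 (factor i *m x) <= q * norm2 x.
Proof.
apply: norm2_stretch => // j; case: ifP => _; last by rewrite normr1.
by rewrite gtr0_norm.
Qed.

Lemma norm2_vec (i : 'I_k) : norm2 (v i) = 1.
Proof.
apply/eqP; rewrite -(@eqrXn2 _ 2) ?norm2_ge0 ?ler01 //.
by rewrite norm2_sqr orthoV eqxx expr1n.
Qed.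

(** Isolates in [t] the error along [v i], which has to be followed separately;
    [f] collects the error of the update and the [O(u^2)] term. *)
Lemma fl_step_error (K u : R) (i : 'I_k) (x z : 'cV[R]_n) :
  0 <= u -> fl_step K u (1 - c i) (v i) x z ->
  exists (t : R) (f : 'cV[R]_n),
    [/\ `|t| <= `|1 - c i| * (gamma n u * norm2 x),
        norm2 f <= u * norm2 (factor i *m x - t *: v i) + K * u ^+ 2 &
        z = factor i *m x - t *: v i + f].
Proof.
move=> u0 [eps [mu [rho [heps hmu hrho ->]]]].
pose t := (1 - c i) * eps.
have E : x - ((1 - c i) * (dotv (v i) x + eps)) *: v i = factor i *m x - t *: v i.
  rewrite /factor stretch_single mulmxBl mul1mx -scalemxAl -mulmxA.
  rewrite [(v i)^T *m x]mx11_scalar mul_mx_scalar scalerA.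
  by rewrite mulrDr scalerDl opprD addrA.
rewrite E; set w := factor i *m x - t *: v i.
exists t, (hadamard w mu + rho); split.
- by rewrite normrM ler_wpM2l.
- apply: le_trans (norm2D _ _) _; apply: lerD => //.
  by apply: le_trans (norm2_hadamard _ _) _; rewrite ler_wpM2r ?norm2_ge0.
- by rewrite addrA; congr (_ + _); apply/matrixP => a b; rewrite !mxE mulrDr mulr1.
Qed.

(** The first bound serves to linearize the next step: it gives
    [|yhat m| <= p |H y| + O(u)], and makes the part of the relative error that
    acts on the previous error [O(u^2)].  The second one, in which [pending m]
    is already applied to the error, is the sharp estimate; it adds up over the
    steps since [pending m.+1 *m factor m = pending m]. *)
Lemma fl_iter_error (K : R) (y : 'cV[R]_n) (m : nat) : (m <= k)%N ->
  exists D C : R, 0 <= D /\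
    forall (u : R) (yhat : nat -> 'cV[R]_n),
      0 < u -> u <= 1 -> 0 <= gamma n u -> gamma n u <= (2 * n%:R) * u ->
      yhat 0%N = y ->
      (forall i : 'I_k, fl_step K u (1 - c i) (v i) (yhat i) (yhat i.+1)) ->
      norm2 (yhat m - applied m *m y) <= D * u /\
      norm2 (pending m *m (yhat m - applied m *m y)) <=
        q * p * norm2 (stretch v c *m y)
          * (m%:R * u + gamma n u * \sum_(i < k | (i < m)%N) `|1 - c i|)
        + C * u ^+ 2.
Proof.
have p0 : 0 <= p := le_trans ler01 p1.
have q0 : 0 <= q := le_trans ler01 q1.
set h := norm2 (stretch v c *m y).
have h0 : 0 <= h := norm2_ge0 _.
elim: m => [|m IH] hm.
  exists 0, 0; split=> // u yhat _ _ _ _ y0 _.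
  have z0 : norm2 (0 : 'cV[R]_n) = 0 by rewrite -(scale0r 0) norm2Z normr0 mul0r.
  rewrite y0 /applied stretch1 // mul1mx subrr mulmx0 z0 !mul0r.
  by rewrite big_pred0 // !(mulr0, addr0).
have [D [C [D0 {}IH]]] := IH (ltnW hm).
pose i := Ordinal hm; pose a := `|1 - c i|.
(* T u will bound the error along v i, and p h u + F u ^+ 2 the other one. *)
pose T := a * (2 * n%:R) * (p * h + D).
pose F := q * D + T + `|K|.
have a0 : 0 <= a := normr_ge0 _.
have T0 : 0 <= T by rewrite /T !mulr_ge0 ?addr_ge0 ?mulr_ge0 ?ler0n.
have F0 : 0 <= F by rewrite /F addr_ge0 // addr_ge0 // mulr_ge0.
exists (q * D + T + p * h + F), (C + a * (2 * n%:R) * D + q * F); split.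
  by rewrite addr_ge0 // addr_ge0 ?[0 <= p * h]mulr_ge0 // addr_ge0 // mulr_ge0.
move=> u yhat u0 u1 g0 gu y0 steps; have u0' := ltW u0.
have {IH} [] := IH u yhat u0 u1 g0 gu y0 steps.
set e := yhat m - _ => eD eC.
have [t [f [ht hf hz]]] := fl_step_error u0' (steps i).
(* The exact step sends the exact iterate to the next exact iterate. *)
have Ef : factor i *m yhat m = applied m.+1 *m y + factor i *m e.
  by rewrite mulmxBr [factor i *m (applied m *m y)](factor_applied i) addrC subrK.
have Ee : yhat m.+1 - applied m.+1 *m y = factor i *m e - t *: v i + f.
  by rewrite [yhat m.+1]hz Ef; apply/eqP; rewrite subr_eq [eqbRHS]addrC !addrA.
have hx : norm2 (yhat m) <= p * h + D * u.
  have -> : yhat m = applied m *m y + e by rewrite addrC subrK.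
  exact: le_trans (norm2D _ _) (lerD (norm2_applied _ _) eD).
have hPe : norm2 (factor i *m e) <= q * D * u.
  by apply: le_trans (norm2_factor _ _) _; rewrite -mulrA ler_wpM2l.
have ntv : norm2 (t *: v i) = `|t| by rewrite norm2Z norm2_vec mulr1.
have {}ht : `|t| <= a * gamma n u * (p * h + D * u).
  apply: le_trans ht _; rewrite -/a -[leRHS]mulrA.
  by apply: ler_wpM2l => //; apply: ler_wpM2l.
have htT : `|t| <= T * u.
  have -> : T * u = a * ((2 * n%:R) * u) * (p * h + D) by rewrite /T; ring.
  apply: le_trans ht _; apply: ler_pM.
  - by apply: mulr_ge0.
  - by rewrite addr_ge0 ?mulr_ge0.
  - by apply: ler_wpM2l.
  - by rewrite lerD2l ler_piMr.
have htD : `|t| <= q * p * h * (gamma n u * a) + a * (2 * n%:R) * D * u ^+ 2.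
  (* The factor q is gained for free here, so that both kinds of error come
     with the same constant. *)
  have h1 : p * h * (gamma n u * a) <= q * (p * h * (gamma n u * a)).
    by apply: ler_peMl => //; apply: mulr_ge0; apply: mulr_ge0.
  have h2 : gamma n u * (a * D * u) <= (2 * n%:R) * u * (a * D * u).
    by apply: ler_wpM2r => //; rewrite !mulr_ge0.
  lra.
have {}hf : norm2 f <= p * h * u + F * u ^+ 2.
  apply: le_trans hf _.
  have : norm2 (factor i *m yhat m - t *: v i) <= p * h + q * D * u + T * u.
    apply: le_trans (norm2D _ _) _; rewrite norm2N ntv lerD // Ef.
    exact: le_trans (norm2D _ _) (lerD (norm2_applied _ _) hPe).
  move=> /(ler_wpM2l u0'); have : K * u ^+ 2 <= `|K| * u ^+ 2.
    by rewrite ler_wpM2r ?sqr_ge0 ?ler_norm.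
  rewrite /F; lra.
rewrite Ee; split.
  apply: le_trans (norm2D _ _) _.
  have := norm2D (factor i *m e) (- (t *: v i)); rewrite norm2N ntv.
  have : F * u ^+ 2 <= F * u.
    by rewrite expr2 mulrA ler_piMr // mulr_ge0.
  lra.
(* The first term is the old error, the second one is still along v i. *)
rewrite mulmxDr mulmxBr (pending_factor i) -scalemxAr (pending_vec i).
apply: le_trans (norm2D _ _) _.
have := norm2D (pending m *m e) (- (t *: v i)); rewrite norm2N ntv.
have := norm2_pending m.+1 f.
have := ler_wpM2l q0 hf.
rewrite (bigD1 i) //= -/a (eq_bigl (fun j : 'I_k => (j < m)%N)); last first.
  by move=> j; rewrite -(inj_eq val_inj) ltnS /= ltn_neqAle andbC.
rewrite -natr1; lra.
Qed.

End ErrorPropagation.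

(** * The error bound *)

Theorem theorem3p4 (R : realType) (n k : nat) (hkn : (k.+1 <= n)%N)
    (v : 'I_k.+1 -> 'cV[R]_n) (hv : orthonormal_family v)
    (lam : 'I_k.+1 -> R)
    (hlam_mono : forall i j : 'I_k.+1, (i <= j)%N -> lam j <= lam i)
    (hlam_pos : forall i : 'I_k.+1, 0 < lam i)
    (theta : R) (htheta : 0 < theta)
    (beta : 'I_k.+1 -> R) (hbeta : exists i : 'I_k.+1, beta i != 0)
    (K : R) :
  let H := Hmat theta lam v in
  let y := yD beta v in
  exists C : R, \forall u \near (0 : R)^'+,
    n%:R * u < 1 :> R ->
    forall z : 'cV[R]_n, fl_H K u theta lam v y z ->
      norm2 (H *m y - z) / norm2 (H *m y)
      <= CD theta (lam ord0) (lam ord_max)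
           * (k.+1%:R * u + gamma n u * \sum_(i < k.+1) `|alpha theta lam i|)
         + C * u ^+ 2.
Proof.
move=> H y.
pose c i := theta / lam i.
pose p := Num.max 1 (lam ord0 / theta).
pose q := Num.max 1 (theta / lam ord_max).
have c_gt0 i : 0 < c i by rewrite divr_gt0.
have c_leq i : c i <= q.
  by rewrite le_max ler_pM2l // lef_pV2 ?posrE // hlam_mono ?orbT // -ltnS.
have cV_lep i : (c i)^-1 <= p.
  by rewrite invf_div le_max ler_pM2r ?invr_gt0 // hlam_mono ?orbT.
have p1 : 1 <= p by rewrite le_max lexx.
have q1 : 1 <= q by rewrite le_max lexx.
have HE x : H *m x = stretch v c *m x := prod_stretch hv c x.
have ybeta i : dotv (v i) y = beta i.
  rewrite dotv_sumr (bigD1 i) //= big1 => [|j ji].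
    by rewrite dotvZr hv eqxx mulr1 addr0.
  by rewrite dotvZr hv eq_sym (negPf ji) mulr0.
have h0 : 0 < norm2 (H *m y).
  rewrite lt0r norm2_ge0 andbT; apply/eqP => /dotv_norm2_0 Hy0.
  have [i] := hbeta; apply/negP; rewrite negbK.
  have := Hy0 (v i); rewrite dotvC HE dotv_stretch // ybeta => /eqP.
  by rewrite mulf_eq0 gt_eqF.
have CDE : CD theta (lam ord0) (lam ord_max) = q * p.
  have l01 : lam ord_max <= lam ord0 by exact: hlam_mono.
  have l0 := hlam_pos ord0; have l1 := hlam_pos ord_max.
  have -> : q = if lam ord_max <= theta then theta / lam ord_max else 1.
    by rewrite /q maxEle ler_pdivlMr // mul1r.
  have -> : p = if lam ord0 <= theta then 1 else lam ord0 / theta.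
    by rewrite /p maxC maxEle ler_pdivrMr // mul1r.
  rewrite /CD; case: ifP => h1; case: ifP => h2 //.
  - by rewrite mulr1.
  - by move: h2; rewrite (le_trans l01 h1).
  - by field; rewrite !gt_eqF.
  - by rewrite mul1r.
have n0 : (0 < n)%N by apply: leq_ltn_trans hkn.
have nR : 1 <= n%:R :> R by rewrite ler1n.
have [D [C [_ main]]] :=
  fl_iter_error hv p1 q1 c_gt0 c_leq cV_lep K y (leqnn k.+1).
exists (C / norm2 (H *m y)); near=> u => _ z [yhat [y0 steps <-]].
have u0 : 0 < u by near: u; exact: nbhs_right_gt.
(* With n u <= 1/2 the denominator 1 - n u of gamma is at least 1/2. *)
have nu : n%:R * u <= 2^-1.
  rewrite mulrC -ler_pdivlMr ?ltr0n //.
  by near: u; apply: nbhs_right_ltW; rewrite divr_gt0 ?ltr0n ?invr_gt0.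
have u1 : u <= 1 by nra.
have g0 : 0 <= gamma n u by rewrite divr_ge0 ?mulr_ge0 // ?ltW //; lra.
have gu : gamma n u <= 2 * n%:R * u.
  rewrite ler_pdivrMr; last lra.
  have : 0 <= n%:R * u * (2^-1 - n%:R * u).
    by rewrite mulr_ge0 ?subr_ge0 // mulr_ge0 // ltW.
  lra.
have [_] := main u yhat u0 u1 g0 gu y0 steps.
rewrite /pending stretch1 => [|j]; last by rewrite ltn_ord.
rewrite mul1mx.
have -> : applied v c k.+1 *m y = H *m y.
  by rewrite HE; congr (_ *m _); apply: eq_stretch => j; rewrite ltn_ord.
rewrite -norm2N opprB -HE => err.
rewrite ler_pdivrMr // mulrDl CDE.
apply: le_trans err _.
have -> : \sum_(i < k.+1 | (i < k.+1)%N) `|1 - c i|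
    = \sum_(i < k.+1) `|alpha theta lam i|.
  by apply: eq_bigl => j; rewrite ltn_ord.
have -> : C / norm2 (H *m y) * u ^+ 2 * norm2 (H *m y) = C * u ^+ 2.
  by rewrite mulrAC divfK ?gt_eqF.
by rewrite lerD2r [leRHS]mulrAC.
Unshelve. all: by end_near.
Qed.
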